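(* Consider the four-node network with the setting described in the context. Under independent network-then-channel decoding at node 4, the achievable rate region $\Lambda_{\text{nc}}$ is the convex hull of all rate pairs $(R_A,R_B)$ satisfying $$R_A \le \mathbb{C}_{1,4}, \qquad R_B \le \mathbb{C}'',$$ where $\mathbb{C}_{1,4} = 1-H(p_{1,4})$ is the capacity of link $1\to 4$ and $\mathbb{C}'' = 1-H(p'')$ is the capacity of a binary symmetric channel with crossover probability $$p'' = p_{1,3}(1-p_{2,3})(1-p_{3,4})(1-p_{1,4}) + (1-p_{1,3})p_{2,3}(1-p_{3,4})(1-p_{1,4}) + (1-p_{1,3})(1-p_{2,3})p_{3,4}(1-p_{1,4}) + (1-p_{1,3})(1-p_{2,3})(1-p_{3,4})p_{1,4} + (1-p_{1,3})p_{2,3}p_{3,4}p_{1,4} + p_{1,3}(1-p_{2,3})p_{3,4}p_{1,4} + p_{1,3}p_{2,3}(1-p_{3,4})p_{1,4} + p_{1,3}p_{2,3}p_{3,4}(1-p_{1,4}).$$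
   Context: Network: nodes $1,2,3,4$ with directed links $1\to3$, $1\to4$, $2\to3$, $3\to4$. Each link $i\to j$ is a binary symmetric channel (BSC) with crossover probability $p_{i,j}$: input $X_{i,j}\in\{0,1\}$, output $Y_{i,j}=X_{i,j}\oplus E_{i,j}$ with $\Pr\{E_{i,j}=1\}=p_{i,j}$; the link channels are independent, time invariant and memoryless. $H(p)=-p\log p-(1-p)\log(1-p)$ is the binary entropy function (base 2), and the capacity of a BSC with crossover $p$ is $1-H(p)$. Messages $A$ and $B$ are independent and uniformly distributed on $\{1,\dots,\lfloor 2^{nR_A}\rfloor\}$ and $\{1,\dots,\lfloor 2^{nR_B}\rfloor\}$, with $n$ the common block length (each link is used $n$ times). Node 1 encodes $A$ with a (linear) channel code into $\mathbf{X}_{1,3}(A)=\mathbf{X}_{1,4}(A)\in\{0,1\}^n$ and sends it on both links $1\to3$ and $1\to4$; node 2 encodes $B$ with a (linear) channel code into $\mathbf{X}_{2,3}(B)\in\{0,1\}^n$ and sends it on link $2\to3$. Node 3 performs no decoding: it transmits $\mathbf{X}_{3,4}=\mathbf{Y}_{1,3}\oplus\mathbf{Y}_{2,3}$ (bitwise XOR). Node 4 must estimate $(\hat A,\hat B)$ from $\mathbf{Y}_{1,4}$ and $\mathbf{Y}_{3,4}$; a rate pair is achievable if $\Pr\{(\hat A,\hat B)\neq(A,B)\}$ can be made arbitrarily small. Independent network-then-channel decoding: node 4 decodes $A$ from $\mathbf{Y}_{1,4}$ alone, and, independently, forms $\mathbf{Y}_{3,4}\oplus\mathbf{Y}_{1,4}$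 and decodes $B$ from it. The achievable rate region of a strategy is the set of rate pairs achievable when node 4 uses that strategy.
   Formalization: The achievable rate region is taken as the closure of the set of achievable nonnegative rate pairs, since pairs exactly at capacity need not be achievable with ⌊2^{nR}⌋ messages; channel codes are arbitrary, not necessarily linear. *)

(* Defs.v *)
From HB Require Import structures.
From mathcomp Require Import all_boot all_order all_algebra.
From mathcomp Require Import all_classical all_reals all_analysis.
Set Implicit Arguments. Unset Strict Implicit. Unset Printing Implicit Defensive.
Import Order.TTheory GRing.Theory Num.Theory.
Local Open Scope ring_scope.

Section Network.
Variable R : realType.

Definition xlog2x (x : R) : R := if x == 0 then 0 else x * ln x / ln 2.

Definition Hb (p : R) : R := - xlog2x p - xlog2x (1 - p).

Definition bsc_cap (p : R) : R := 1 - Hb p.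

Definition p_dd (p13 p23 p34 p14 : R) : R :=
    p13 * (1 - p23) * (1 - p34) * (1 - p14)
  + (1 - p13) * p23 * (1 - p34) * (1 - p14)
  + (1 - p13) * (1 - p23) * p34 * (1 - p14)
  + (1 - p13) * (1 - p23) * (1 - p34) * p14
  + (1 - p13) * p23 * p34 * p14
  + p13 * (1 - p23) * p34 * p14
  + p13 * p23 * (1 - p34) * p14
  + p13 * p23 * p34 * (1 - p14).

Definition word (n : nat) := {ffun 'I_n -> bool}.

Definition wxor n (x y : word n) : word n := [ffun i => x i (+) y i].

Definition bsc_weight n (p : R) (e : word n) : R :=
  \prod_(i < n) (if e i then p else 1 - p).

Definition nmsg (n : nat) (r : R) : nat := Num.truncn (2 `^ (n%:R * r)).

(* A block-length-n code for the network under independent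
   network-then-channel decoding: encoders at nodes 1 and 2, and
   node-4 decoders decA (applied to Y14) and decB (applied to Y34 xor Y14). *)
Record nc_code (n MA MB : nat) := NCCode {
  encA : 'I_MA -> word n;   (* X13 = X14 *)
  encB : 'I_MB -> word n;
  decA : word n -> 'I_MA;
  decB : word n -> 'I_MB }.

(* Probability that (A^,B^) <> (A,B), with A, B uniform and independent and the
   four link noises independent i.i.d. Bernoulli. Node 3 forwards
   X34 = Y13 xor Y23. *)
Definition nc_error (p13 p14 p23 p34 : R) n MA MB (c : nc_code n MA MB) : R :=
  \sum_(a : 'I_MA) \sum_(b : 'I_MB) (MA%:R)^-1 * (MB%:R)^-1 *
  \sum_(e13 : word n) \sum_(e14 : word n) \sum_(e23 : word n) \sum_(e34 : word n)
    bsc_weight p13 e13 * bsc_weight p14 e14 * bsc_weight p23 e23 *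
    bsc_weight p34 e34 *
    (let y13 := wxor (encA c a) e13 in
     let y14 := wxor (encA c a) e14 in
     let y23 := wxor (encB c b) e23 in
     let x34 := wxor y13 y23 in
     let y34 := wxor x34 e34 in
     if (decA c y14 == a) && (decB c (wxor y34 y14) == b) then 0 else 1).

Definition nc_achievable (p13 p14 p23 p34 : R) (RA RB : R) : Prop :=
  0 <= RA /\ 0 <= RB /\
  forall eps : R, 0 < eps -> exists N : nat, forall n : nat, (N <= n)%N ->
    exists c : nc_code n (nmsg n RA) (nmsg n RB),
      nc_error p13 p14 p23 p34 c <= eps.

Definition nc_region (p13 p14 p23 p34 : R) : set (R * R) :=
  [set r | forall d : R, 0 < d -> exists RA RB,
      nc_achievable p13 p14 p23 p34 RA RB /\
      `|RA - r.1| < d /\ `|RB - r.2| < d].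

Definition convex_set2 (S : set (R * R)) : Prop :=
  forall x y t, S x -> S y -> 0 <= t -> t <= 1 ->
    S (t * x.1 + (1 - t) * y.1, t * x.2 + (1 - t) * y.2).

Definition conv_hull2 (S : set (R * R)) : set (R * R) :=
  [set r | forall T : set (R * R), convex_set2 T -> (forall x, S x -> T x) -> T r].

End Network.

(* Main.v *)
Require Import Defs.
From HB Require Import structures.
From mathcomp Require Import all_boot all_order all_algebra.
From mathcomp Require Import all_classical all_reals all_analysis.
From mathcomp Require Import ring lra.
Import Order.TTheory GRing.Theory Num.Theory.
Local Open Scope ring_scope.

(** The word that node 4 feeds to its decoder of B is X23(B) plus the sum of the
    four noises, a Bernoulli word of parameter p''; so the two decoders see
    binary symmetric channels of crossover p14 and p'', and the joint error
    probability lies between the maximum and the sum of the two individual ones.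
    The two noises need not be independent for this.
    For one channel, Chebyshev's inequality shows that the noise word is typical,
    i.e. has weight about 2^(-n H), with probability 1 - O(1/n).  Below capacity,
    a random codebook with decoding by typicality errs with probability at most
    Pr(atypical) + M |T| / 2^n.  Above capacity, the decoding regions are
    disjoint, so any code is correct with probability at most
    Pr(atypical) + 2^n 2^(-n (H - d)) / M.  The limit region is thus a box, which
    is its own convex hull. *)

(** * Noise words: independence, entropy and typical sets *)

Section Noise.
Set Implicit Arguments.
Unset Strict Implicit.
Variable R : realType.
Implicit Types (p : R) (n : nat).

Definition bern p (b : bool) : R := if b then p else 1 - p.

Lemma bern_ge0 p b : 0 <= p <= 1 -> 0 <= bern p b.
Proof. by case/andP=> p0 p1; case: b; rewrite /bern ?subr_ge0. Qed.

Lemma sum_bern p : \sum_b bern p b = 1.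
Proof. by rewrite big_bool /bern /= addrC subrK. Qed.

Lemma bsc_weight_ge0 n p (e : word n) : 0 <= p <= 1 -> 0 <= bsc_weight p e.
Proof. by move=> hp; apply: prodr_ge0 => i _; exact: bern_ge0. Qed.

(** Independence of the bits: expanding the product of sums by distributivity gives one term per
    word. *)
Lemma sum_bsc_weightM n p (g : 'I_n -> bool -> R) :
  \sum_(e : word n) bsc_weight p e * \prod_i g i (e i) =
  \prod_i \sum_b bern p b * g i b.
Proof.
rewrite bigA_distr_bigA /=; apply: eq_bigr => e _.
by rewrite -big_split.
Qed.

Lemma sum_bsc_weight n p : \sum_(e : word n) bsc_weight p e = 1.
Proof.
transitivity (\prod_(i < n) \sum_b bern p b * 1).
  rewrite -(sum_bsc_weightM _ (fun _ _ => 1)).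
  by apply: eq_bigr => e _; rewrite big1 ?mulr1.
by apply: big1 => i _; under eq_bigr do rewrite mulr1; rewrite sum_bern.
Qed.

(** Variances of independent centred variables add: once the square is expanded, every off-diagonal
    term has a factor of mean zero. *)
Lemma second_moment n p (h : bool -> R) : \sum_b bern p b * h b = 0 ->
  \sum_(e : word n) bsc_weight p e * (\sum_i h (e i)) ^+ 2 =
  n%:R * \sum_b bern p b * h b ^+ 2.
Proof.
move=> h0.
transitivity (\sum_(i < n) \sum_(j < n) \sum_(e : word n)
    bsc_weight p e * (h (e i) * h (e j))).
  under [RHS]eq_bigr => i _ do rewrite exchange_big /=.
  rewrite [RHS]exchange_big /=; apply: eq_bigr => e _.
  rewrite expr2 mulr_suml mulr_sumr; apply: eq_bigr => i _.
  by rewrite mulr_sumr mulr_sumr.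
have key (i j : 'I_n) : \sum_(e : word n) bsc_weight p e * (h (e i) * h (e j)) =
    if j == i then \sum_b bern p b * h b ^+ 2 else 0.
  (* Two separate factors, so that [i = j] yields the square of [h] and both cases share one product
     formula. *)
  pose g k b : R := (if k == i then h b else 1) * (if k == j then h b else 1).
  transitivity (\sum_(e : word n) bsc_weight p e * \prod_k g k (e k)).
    apply: eq_bigr => e _; congr (_ * _).
    by rewrite big_split /= -!big_mkcond !big_pred1_eq.
  rewrite sum_bsc_weightM (bigD1 i) //= /g eqxx.
  rewrite (eq_sym j); case: eqP => [<-|/eqP ij].
    rewrite [X in _ * X]big1 ?mulr1 => [|k]; first by [].
    move=> /negbTE ->.
    by under eq_bigr do rewrite !mulr1; rewrite sum_bern.
  by under eq_bigr do rewrite mulr1; rewrite h0 mul0r.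
under eq_bigr => i _ do under eq_bigr do rewrite key.
under eq_bigr => i _ do rewrite -big_mkcond big_pred1_eq.
by rewrite sumr_const card_ord mulr_natl.
Qed.

Definition entropy_nat p : R := Hb p * ln 2.

(** Information content of one bit in nats, centred at its mean, the entropy. *)
Definition surprisal p (b : bool) : R := - ln (bern p b) - entropy_nat p.

Definition surprisal_var p : R := \sum_b bern p b * surprisal p b ^+ 2.

Lemma ln2_gt0 : 0 < ln 2 :> R.
Proof. by rewrite ln_gt0 // ltr1n. Qed.

Lemma entropy_natE p : entropy_nat p = - (p * ln p) - (1 - p) * ln (1 - p).
Proof.
(* The special case of [xlog2x] at 0 agrees with the plain formula, whose factor [x] vanishes
   there. *)
have xE (x : R) : xlog2x x = x * ln x / ln 2.
  by rewrite /xlog2x; case: eqP => // ->; rewrite !mul0r.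
rewrite /entropy_nat /Hb !xE; field; exact: lt0r_neq0 ln2_gt0.
Qed.

Lemma mean_surprisal p : \sum_b bern p b * surprisal p b = 0.
Proof. by rewrite big_bool /surprisal /bern /= entropy_natE; ring. Qed.

Lemma surprisal_var_ge0 p : 0 <= p <= 1 -> 0 <= surprisal_var p.
Proof.
by move=> hp; apply: sumr_ge0 => b _; rewrite mulr_ge0 ?sqr_ge0 ?bern_ge0.
Qed.

(* Words of weight 0 must be excluded: there ln 0 = 0 breaks the identity
   weight = expR (- sum of the ln) that ties surprisal to weight. *)
Definition typical n p (d : R) : pred (word n) := fun e =>
  (bsc_weight p e != 0) && (`|\sum_i surprisal p (e i)| <= n%:R * d).

(** Chebyshev's inequality for the total surprisal; atypical words of weight 0 contribute
    nothing. *)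
Lemma atypical_le n p d : 0 <= p <= 1 -> 0 < d -> (0 < n)%N ->
  \sum_(e : word n | ~~ typical p d e) bsc_weight p e <=
  surprisal_var p / d ^+ 2 / n%:R.
Proof.
move=> hp d0 n0.
have nd0 : 0 < n%:R * d by rewrite mulr_gt0 ?ltr0n.
have -> : surprisal_var p / d ^+ 2 / n%:R =
    n%:R * surprisal_var p / (n%:R * d) ^+ 2.
  by field; rewrite (lt0r_neq0 d0) pnatr_eq0 -lt0n n0.
rewrite ler_pdivlMr ?exprn_gt0 // -(second_moment _ (mean_surprisal p)).
rewrite mulr_suml [leRHS](bigID (typical p d)) /=.
rewrite -[leLHS]add0r lerD //.
  by apply: sumr_ge0 => e _; rewrite mulr_ge0 ?sqr_ge0 ?bsc_weight_ge0.
apply: ler_sum => e; rewrite /typical negb_and negbK.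
case/orP => [/eqP ->|]; first by rewrite !mul0r.
rewrite -ltNge => lt_nd; apply: ler_wpM2l; first exact: bsc_weight_ge0.
by rewrite -[leRHS]real_normK ?num_real // lerXn2r ?nnegrE ?(ltW nd0) // ltW.
Qed.

Lemma bsc_weightE n p (e : word n) : 0 <= p <= 1 -> bsc_weight p e != 0 ->
  bsc_weight p e = expR (- \sum_i surprisal p (e i) - n%:R * entropy_nat p).
Proof.
move=> hp /prodf_neq0 Wn0.
rewrite -sumrN mulr_natl -[n in _ *+ n]card_ord -sumr_const -sumrB expR_sum.
apply: eq_bigr => i _; rewrite /surprisal opprB opprK addrAC subrr add0r.
by rewrite lnK // posrE lt0r Wn0 //= bern_ge0.
Qed.

Lemma typical_weight n p d (e : word n) : 0 <= p <= 1 -> typical p d e ->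
  expR (- (n%:R * (entropy_nat p + d))) <= bsc_weight p e
    <= expR (- (n%:R * (entropy_nat p - d))).
Proof.
move=> hp /andP[W0]; rewrite ler_norml => /andP[lo hi].
rewrite bsc_weightE // !ler_expR; lra.
Qed.

(** The weights sum to 1, and each typical word takes at least
    [expR (- (n%:R * (entropy_nat p + d)))] of it. *)
Lemma card_typical n p d : 0 <= p <= 1 ->
  #|typical (n := n) p d|%:R <= expR (n%:R * (entropy_nat p + d)).
Proof.
move=> hp; rewrite -[leRHS]mul1r -ler_pdivrMr ?expR_gt0 // -expRN.
rewrite mulrC mulr_natr -sumr_const -[leRHS](sum_bsc_weight n p).
rewrite [leRHS](bigID (mem (typical p d))) /= -[leLHS]addr0 lerD //.
  by apply: ler_sum => e /(typical_weight hp)/andP[].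
by apply: sumr_ge0 => e _; exact: bsc_weight_ge0.
Qed.

End Noise.

(** * Codes of fixed length on one binary symmetric channel *)

Section Coding.
Set Implicit Arguments.
Unset Strict Implicit.
Variable R : realType.
Implicit Types (p q : R) (n M : nat).

Lemma wxorC n (x y : word n) : wxor x y = wxor y x.
Proof. by apply/ffunP => i; rewrite !ffunE addbC. Qed.

Lemma wxorA n (x y z : word n) : wxor x (wxor y z) = wxor (wxor x y) z.
Proof. by apply/ffunP => i; rewrite !ffunE addbA. Qed.

Lemma wxorK n (x : word n) : involutive (wxor x).
Proof. by move=> y; apply/ffunP => i; rewrite !ffunE addKb. Qed.

Definition bsc_error p n M (enc : 'I_M -> word n) (dec : word n -> 'I_M) : R :=
  \sum_a M%:R^-1 * \sum_e bsc_weight p e * (dec (wxor (enc a) e) != a)%:R.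

(* Averaging over the translates f m' + z, z ranging over all words, makes the
   codeword of m' uniform and independent of that of a. *)
Lemma sum_codebook_xor n M (T : pred (word n)) (a m' : 'I_M) (e : word n) :
  m' != a ->
  #|{: word n}|%:R *
    \sum_(f : {ffun 'I_M -> word n}) (T (wxor (f m') (wxor (f a) e)))%:R =
  #|{ffun 'I_M -> word n}|%:R * #|T|%:R :> R.
Proof.
move=> m'a.
pose shift z (f : {ffun 'I_M -> word n}) : {ffun 'I_M -> word n} :=
  [ffun m => if m == m' then wxor z (f m) else f m].
have shiftK z : involutive (shift z).
  by move=> f; apply/ffunP => m; rewrite !ffunE; case: eqP; rewrite ?wxorK.
transitivity (\sum_(z : word n) \sum_(f : {ffun 'I_M -> word n})
    (T (wxor (wxor z (f m')) (wxor (f a) e)))%:R : R).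
  rewrite [LHS]mulr_natl -[LHS]sumr_const; apply: eq_bigr => z _.
  rewrite (reindex_inj (inv_inj (shiftK z))); apply: eq_bigr => f _.
  by rewrite !ffunE eqxx eq_sym (negbTE m'a).
rewrite exchange_big /= [RHS]mulr_natl -[RHS]sumr_const; apply: eq_bigr => f _.
(* Translating [z] by [c] turns the tested word into [z] itself, so the sum counts [T]. *)
pose c := wxor (f m') (wxor (f a) e).
rewrite (reindex_inj (inv_inj (wxorK c))) /= -sum1_card natr_sum [RHS]big_mkcond /=.
apply: eq_bigr => z _.
have -> : wxor (wxor (wxor c z) (f m')) (wxor (f a) e) = z.
  by rewrite -wxorA -/c wxorC wxorK.
by rewrite unfold_in; case: (T z).
Qed.

(** [wxor (f m) y] is the noise that would turn codeword [f m] into [y]. Any message passing the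
    test may be picked, unique or not; [m0] is the default when none passes. *)
Definition typ_dec n M (m0 : 'I_M) (T : pred (word n)) (f : 'I_M -> word n)
  (y : word n) : 'I_M := odflt m0 [pick m | T (wxor (f m) y)].

(** Union bound: if [T e] holds then [a] passes the test, so a wrong answer must be another message
    that passes it. *)
Lemma typ_dec_err n M (m0 : 'I_M) (T : pred (word n)) (f : 'I_M -> word n) a e :
  (typ_dec m0 T f (wxor (f a) e) != a)%:R <=
  (~~ T e)%:R + \sum_(m' | m' != a) (T (wxor (f m') (wxor (f a) e)))%:R :> R.
Proof.
have ge0 (P : pred 'I_M) : 0 <= \sum_(m' | P m') (T (wxor (f m') (wxor (f a) e)))%:R :> R.
  by apply: sumr_ge0 => m _; rewrite ler0n.
have [_|ne] := eqVneq (typ_dec m0 T f (wxor (f a) e)) a; first exact: addr_ge0.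
have [Te|_] := boolP (T e); last by rewrite lerDl.
move: ne; rewrite /typ_dec; case: pickP => [m Tm /= ma|/(_ a)]; last first.
  by rewrite wxorK Te.
by rewrite add0r (bigD1 m) //= Tm lerDl ge0.
Qed.

(** The bound holds for the error averaged over all codebooks, hence for at least one of them. *)
Lemma random_coding n M p (m0 : 'I_M) (T : pred (word n)) : 0 <= p <= 1 ->
  exists (enc : 'I_M -> word n) dec,
    bsc_error p enc dec <=
    \sum_(e | ~~ T e) bsc_weight p e + M%:R * #|T|%:R / 2 ^+ n.
Proof.
move=> hp; pose B : R := \sum_(e | ~~ T e) bsc_weight p e + M%:R * #|T|%:R / 2 ^+ n.
rewrite -/B.
have M0 : (0 < M)%N by exact: leq_ltn_trans (leq0n m0) (ltn_ord m0).
have M0R : 0 < M%:R :> R by rewrite ltr0n.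
pose F := {ffun 'I_M -> word n}.
have cardW : #|{: word n}|%:R = 2 ^+ n :> R.
  by rewrite card_ffun card_bool card_ord natrX.
suff [f hf] : exists f : F, bsc_error p f (typ_dec m0 T f) <= B.
  by exists f, (typ_dec m0 T f).
apply: contrapT => nex.
have : #|F|%:R * B < \sum_(f : F) bsc_error p f (typ_dec m0 T f).
  rewrite [ltLHS]mulr_natl -[ltLHS]sumr_const; apply: ltr_sum.
    by apply/hasP; exists [ffun=> [ffun=> false]]; rewrite ?mem_index_enum.
  by move=> f _; rewrite ltNge; apply/negP => hf; apply: nex; exists f.
apply/negP; rewrite -leNgt.
rewrite /bsc_error exchange_big /=.
have -> : #|F|%:R * B = \sum_(a : 'I_M) M%:R^-1 * (#|F|%:R * B).
  by rewrite sumr_const card_ord -[RHS]mulr_natl mulrA divff ?mul1r ?lt0r_neq0.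
apply: ler_sum => a _; rewrite -mulr_sumr; apply: ler_wpM2l; first by rewrite invr_ge0 ltW.
rewrite exchange_big /=.
(* The bound is spread over the noise words, whose weights sum to 1, so that it can be checked for
   each [e]. *)
have -> : #|F|%:R * B = \sum_(e : word n) bsc_weight p e *
    (#|F|%:R * (~~ T e)%:R + M%:R * (#|F|%:R * #|T|%:R / 2 ^+ n)).
  under eq_bigr do rewrite mulrDr.
  rewrite big_split /= -mulr_suml sum_bsc_weight mul1r /B mulrDr; congr (_ + _); last by ring.
  rewrite mulr_sumr big_mkcond; apply: eq_bigr => e _.
  by case: (T e); rewrite /= ?mulr0 ?mulr1 // mulrC.
apply: ler_sum => e _; rewrite -mulr_sumr; apply: ler_wpM2l; first exact: bsc_weight_ge0.
apply: (@le_trans _ _ (\sum_(f : F) ((~~ T e)%:R +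
    \sum_(m' | m' != a) (T (wxor (f m') (wxor (f a) e)))%:R))).
  by apply: ler_sum => f _; exact: typ_dec_err.
rewrite big_split /= sumr_const -[X in X + _]mulr_natl lerD //.
rewrite exchange_big /=.
(* Each wrong message passes the test for a fraction [#|T| / 2 ^+ n] of the codebooks. *)
rewrite (eq_bigr (fun=> #|F|%:R * #|T|%:R / 2 ^+ n)); last first.
  move=> m' m'a; rewrite -(sum_codebook_xor T e m'a) cardW; field.
  by rewrite lt0r_neq0 // exprn_gt0.
rewrite sumr_const -[leLHS]mulr_natl ler_wpM2r //.
by rewrite ler_nat -[leqRHS]card_ord max_card.
Qed.

Lemma strong_converse n M p d (enc : 'I_M -> word n) dec : 0 <= p <= 1 ->
  (0 < M)%N ->
  1 - bsc_error p enc dec <=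
  \sum_(e : word n | ~~ typical p d e) bsc_weight p e +
  2 ^+ n * expR (- (n%:R * (entropy_nat p - d))) / M%:R.
Proof.
move=> hp M0; have M0R : 0 < M%:R :> R by rewrite ltr0n.
set K := expR _; set A := \sum_(e | _) _.
pose ok a y : R := (dec y == a)%:R.
have -> : 1 - bsc_error p enc dec =
    M%:R^-1 * \sum_a \sum_e bsc_weight p e * ok a (wxor (enc a) e).
  rewrite /bsc_error -mulr_sumr.
  have {1}-> : 1 = M%:R^-1 * \sum_(a : 'I_M) \sum_(e : word n) bsc_weight p e :> R.
    by rewrite sum_bsc_weight sumr_const card_ord mulVf // lt0r_neq0.
  rewrite -mulrBr -sumrB; congr (_ * _); apply: eq_bigr => a _.
  rewrite -sumrB; apply: eq_bigr => e _; rewrite /ok.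
  by case: eqP => _; rewrite ?mulr0 ?mulr1 ?subr0 ?subrr.
rewrite mulrC ler_pdivrMr // mulrDl divfK ?lt0r_neq0 //.
(* Atypical noise is counted as always decoded correctly; typical noise weighs at most [K]. *)
apply: (@le_trans _ _ (\sum_(a : 'I_M) (A + K * \sum_e ok a (wxor (enc a) e)))).
  apply: ler_sum => a _; rewrite /A mulr_sumr [in leRHS]big_mkcond -big_split /=.
  apply: ler_sum => e _.
  have W0 := bsc_weight_ge0 e hp.
  have ok0 : 0 <= ok a (wxor (enc a) e) <= 1.
    by rewrite ler0n lern1 leq_b1.
  have [te|_] /= := boolP (typical p d e).
    rewrite add0r; case/andP: ok0 => ok0 _; apply: ler_wpM2r => //.
    by case/andP: (typical_weight hp te).
  case/andP: ok0 => ok0 ok1.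
  by rewrite -[leLHS]addr0 lerD ?mulr_ge0 ?expR_ge0 // ler_piMr.
rewrite big_split /= sumr_const card_ord mulr_natr lerD2l -mulr_sumr mulrC.
rewrite ler_wpM2r ?expR_ge0 //.
have -> : 2 ^+ n = \sum_(y : word n) 1 :> R.
  by rewrite sumr_const card_ffun card_bool card_ord natrX.
(* Summing over received words instead of noise removes the encoder; each [y] is then correct for
   exactly one message. *)
have shift a : \sum_e ok a (wxor (enc a) e) = \sum_y ok a y.
  by rewrite [RHS](reindex_inj (inv_inj (wxorK (enc a)))).
under eq_bigr => a _ do rewrite shift.
rewrite exchange_big /=; apply: ler_sum => y _.
by rewrite (bigD1 (dec y)) //= /ok eqxx big1 ?addr0 // => a; rewrite eq_sym => /negbTE ->.
Qed.

End Coding.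

(** * Coding theorem and converse for one channel as the length grows *)

Section Asymptotics.
Set Implicit Arguments.
Unset Strict Implicit.
Variable R : realType.
Implicit Types (p q : R) (n M : nat).

Lemma eventually_divn_le (c eps : R) : 0 < eps ->
  exists N : nat, forall n, (N <= n)%N -> (0 < n)%N /\ c / n%:R <= eps.
Proof.
move=> eps0; exists (Num.truncn (`|c| / eps)).+1 => n ltn.
have n0 : (0 < n)%N by exact: leq_trans ltn.
split=> //; rewrite ler_pdivrMr ?ltr0n // mulrC -ler_pdivrMr //.
have : `|c| / eps < n%:R.
  by apply: lt_le_trans (truncnS_gt _) _; rewrite ler_nat.
move/ltW; apply: le_trans; rewrite ler_pM2r ?invr_gt0 //; exact: ler_norm.
Qed.

(** Brings exponential terms to the same [c / n] form as the Chebyshev bound, so that one threshold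
    serves both. *)
Lemma expRN_le_inv n (d : R) : (0 < n)%N -> 0 < d ->
  expR (- (n%:R * d)) <= d^-1 / n%:R.
Proof.
move=> n0 d0; have nd0 : 0 < n%:R * d by rewrite mulr_gt0 ?ltr0n.
rewrite expRN -invfM mulrC lef_pV2 ?posrE ?expR_gt0 //; last by rewrite mulrC.
by rewrite (le_trans _ (expR_ge1Dx _)) // mulrC lerDr.
Qed.

Lemma pow2_expR n : 2 ^+ n = expR (n%:R * ln 2) :> R.
Proof. by rewrite expRM_natl lnK // posrE. Qed.

(** For a real at least 1, truncation loses at most a factor 2. *)
Lemma nmsg_bounds n (r : R) : 0 <= r ->
  [/\ (0 < nmsg n r)%N, (nmsg n r)%:R <= expR (n%:R * (r * ln 2))
    & expR (n%:R * (r * ln 2)) <= 2 * (nmsg n r)%:R].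
Proof.
move=> r0; rewrite /nmsg.
have -> : 2 `^ (n%:R * r) = expR (n%:R * (r * ln 2)).
  by rewrite /powR pnatr_eq0 /= mulrA.
set x := expR _.
have x1 : 1 <= x by rewrite -expR0 ler_expR !mulr_ge0 ?ler0n // ltW // ln2_gt0.
have x0 : 0 <= x by exact: le_trans x1.
have /andP[lo hi] := truncn_itv x0.
have t0 : (0 < Num.truncn x)%N by rewrite truncn_gt0.
split=> //; have : 1 <= (Num.truncn x)%:R :> R by rewrite ler1n.
by move: hi; rewrite -natr1; lra.
Qed.

Lemma bsc_cap_nat p : bsc_cap p * ln 2 = ln 2 - entropy_nat p.
Proof. by rewrite /bsc_cap /entropy_nat mulrBl mul1r. Qed.

(** Rate 0 is a separate case because the capacity may itself be 0; there is then a single message,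
    which cannot be misdecoded. *)
Lemma bsc_direct p (r : R) : 0 <= p <= 1 -> 0 <= r -> r = 0 \/ r < bsc_cap p ->
  forall eps : R, 0 < eps -> exists N : nat, forall n, (N <= n)%N ->
    exists (enc : 'I_(nmsg n r) -> word n) dec, bsc_error p enc dec <= eps.
Proof.
move=> hp r0 [-> | rC] eps eps0.
  exists 0 => n _.
  have m1 : nmsg n (0 : R) = 1 by rewrite /nmsg mulr0 powRr0 truncn1.
  have sub (a b : 'I_(nmsg n (0 : R))) : a = b.
    by apply/val_inj; case: a b => [a +] [b +]; rewrite /= m1; case: a; case: b.
  have m0 : 'I_(nmsg n (0 : R)) by rewrite m1; exact: ord0.
  exists (fun=> [ffun=> false]), (fun=> m0); rewrite /bsc_error big1 ?ltW // => a _.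
  by rewrite (sub m0 a) eqxx big1 ?mulr0 // => e _; rewrite mulr0.
(* Half the gap to capacity in nats: typicality costs one half, and the other leaves
   [expR (- (n%:R * d))]. *)
pose d := (bsc_cap p * ln 2 - r * ln 2) / 2.
have d0 : 0 < d by rewrite divr_gt0 // subr_gt0 ltr_pM2r // ln2_gt0.
have [N hN] := eventually_divn_le (surprisal_var p / d ^+ 2 + d^-1) eps0.
exists N => n /hN[n0 hn].
have [M0 Mle _] := nmsg_bounds n r0.
have [enc [dec err]] := random_coding (Ordinal M0) (typical (n := n) p d) hp.
exists enc, dec; apply: (le_trans err); apply: le_trans hn.
rewrite mulrDl lerD ?atypical_le //.
apply: le_trans (expRN_le_inv n0 d0).
rewrite ler_pdivrMr ?exprn_gt0 // pow2_expR -expRD.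
apply: (le_trans (ler_pM _ _ Mle (card_typical n d hp))) => //.
rewrite -expRD ler_expR.
have -> : entropy_nat p = ln 2 - bsc_cap p * ln 2 by rewrite bsc_cap_nat; ring.
by rewrite le_eqVlt; apply/orP; left; apply/eqP; rewrite /d; field.
Qed.

Lemma bsc_converse p (r : R) : 0 <= p <= 1 -> 0 <= r -> bsc_cap p < r ->
  exists N : nat, forall n, (N <= n)%N ->
    forall (enc : 'I_(nmsg n r) -> word n) dec, 1 / 2 <= bsc_error p enc dec.
Proof.
move=> hp r0 rC.
pose d := (r * ln 2 - bsc_cap p * ln 2) / 2.
have d0 : 0 < d by rewrite divr_gt0 // subr_gt0 ltr_pM2r // ln2_gt0.
have half0 : 0 < 1 / 2 :> R by [].
have [N hN] := eventually_divn_le (surprisal_var p / d ^+ 2 + 2 * d^-1) half0.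
exists N => n /hN[n0 hn] enc dec.
have [M0 _ leM] := nmsg_bounds n r0.
suff : 1 - bsc_error p enc dec <= 1 / 2 by lra.
apply: le_trans (strong_converse d enc dec hp M0) _; apply: le_trans hn.
rewrite mulrDl lerD ?atypical_le //.
(* The factor 2 pays for the truncation in [nmsg]. *)
apply: (@le_trans _ _ (2 * expR (- (n%:R * d)))); last first.
  by rewrite -mulrA ler_pM2l // expRN_le_inv.
rewrite ler_pdivrMr ?ltr0n // [2 * _]mulrC -[leRHS]mulrA.
apply: le_trans (ler_wpM2l (expR_ge0 _) leM).
rewrite pow2_expR -!expRD ler_expR.
have -> : entropy_nat p = ln 2 - bsc_cap p * ln 2 by rewrite bsc_cap_nat; ring.
by rewrite le_eqVlt; apply/orP; left; apply/eqP; rewrite /d; field.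
Qed.

End Asymptotics.

(** * Sums of independent noises and the crossover p'' *)

Section Network.
Set Implicit Arguments.
Unset Strict Implicit.
Variable R : realType.
Implicit Types (p q : R) (n : nat).

(** Crossover of two channels in cascade: the probability that exactly one of two independent bits
    is 1. *)
Definition bsc_conv p q : R := p * (1 - q) + (1 - p) * q.

Lemma bsc_conv_itv p q : 0 <= p <= 1 -> 0 <= q <= 1 -> 0 <= bsc_conv p q <= 1.
Proof. by rewrite /bsc_conv => /andP[? ?] /andP[? ?]; apply/andP; split; nra. Qed.

(** Replacing [f] by [wxor e f] gives a convolution of the two laws, which factors bit by bit. *)
Lemma sum_bsc_conv n p q (F : word n -> R) :
  \sum_(e : word n) \sum_(f : word n)
    bsc_weight p e * bsc_weight q f * F (wxor e f) =
  \sum_(e : word n) bsc_weight (bsc_conv p q) e * F e.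
Proof.
transitivity (\sum_(e : word n) \sum_(f : word n)
    bsc_weight p e * bsc_weight q (wxor e f) * F f).
  apply: eq_bigr => e _; rewrite (reindex_inj (inv_inj (wxorK e))).
  by apply: eq_bigr => f _; rewrite wxorK.
rewrite exchange_big /=; apply: eq_bigr => f _; rewrite -mulr_suml; congr (_ * _).
transitivity (\sum_(e : word n) bsc_weight p e * \prod_i bern q (e i (+) f i)).
  by apply: eq_bigr => e _; congr (_ * _); apply: eq_bigr => i _; rewrite ffunE.
rewrite (sum_bsc_weightM _ (fun i b => bern q (b (+) f i))).
apply: eq_bigr => i _; rewrite big_bool /bern /bsc_conv /=.
by case: (f i); rewrite /=; ring.
Qed.

(** The eight terms of [p_dd] are the patterns with an odd number of errors among four bits. *)
Lemma p_ddE (p13 p14 p23 p34 : R) :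
  p_dd p13 p23 p34 p14 = bsc_conv (bsc_conv (bsc_conv p13 p14) p23) p34.
Proof. by rewrite /p_dd /bsc_conv; ring. Qed.

Lemma p_dd_itv (p13 p14 p23 p34 : R) : 0 <= p13 <= 1 -> 0 <= p14 <= 1 ->
  0 <= p23 <= 1 -> 0 <= p34 <= 1 -> 0 <= p_dd p13 p23 p34 p14 <= 1.
Proof. by move=> *; rewrite p_ddE; do !apply: bsc_conv_itv. Qed.

(** * The network error compared with the two single-channel errors *)

Section Code.
Variables (p13 p14 p23 p34 : R) (n MA MB : nat).
Hypotheses (h13 : 0 <= p13 <= 1) (h14 : 0 <= p14 <= 1).
Hypotheses (h23 : 0 <= p23 <= 1) (h34 : 0 <= p34 <= 1).
Hypotheses (MA0 : (0 < MA)%N) (MB0 : (0 < MB)%N).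

Definition nc_mean
    (G : 'I_MA -> 'I_MB -> word n -> word n -> word n -> word n -> R) : R :=
  \sum_(a : 'I_MA) \sum_(b : 'I_MB) (MA%:R)^-1 * (MB%:R)^-1 *
  \sum_(e13 : word n) \sum_(e14 : word n) \sum_(e23 : word n) \sum_(e34 : word n)
    bsc_weight p13 e13 * bsc_weight p14 e14 * bsc_weight p23 e23 *
    bsc_weight p34 e34 * G a b e13 e14 e23 e34.

Lemma nc_mean_le G G' :
  (forall a b e13 e14 e23 e34, G a b e13 e14 e23 e34 <= G' a b e13 e14 e23 e34) ->
  nc_mean G <= nc_mean G'.
Proof.
move=> le; apply: ler_sum => a _; apply: ler_sum => b _.
apply: ler_wpM2l; first by rewrite mulr_ge0 ?invr_ge0.
apply: ler_sum => e13 _; apply: ler_sum => e14 _; apply: ler_sum => e23 _.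
apply: ler_sum => e34 _; apply: ler_wpM2l => //.
by rewrite !mulr_ge0 ?bsc_weight_ge0.
Qed.

Lemma nc_meanD G G' :
  nc_mean (fun a b e13 e14 e23 e34 => G a b e13 e14 e23 e34 + G' a b e13 e14 e23 e34)
  = nc_mean G + nc_mean G'.
Proof.
rewrite /nc_mean -big_split /=; apply: eq_bigr => a _.
rewrite -big_split /=; apply: eq_bigr => b _ /=; rewrite -mulrDr; congr (_ * _).
rewrite -[RHS]big_split /=; apply: eq_bigr => e13 _.
rewrite -[RHS]big_split /=; apply: eq_bigr => e14 _.
rewrite -[RHS]big_split /=; apply: eq_bigr => e23 _.
by rewrite -[RHS]big_split /=; apply: eq_bigr => e34 _; rewrite mulrDr.
Qed.

Variable c : nc_code n MA MB.

Definition errA (a : 'I_MA) (b : 'I_MB) (e13 e14 e23 e34 : word n) : R :=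
  (decA c (wxor (encA c a) e14) != a)%:R.

(** The noises are nested as the cascade in [p_ddE], so that they can be merged one at a time. *)
Definition errB (a : 'I_MA) (b : 'I_MB) (e13 e14 e23 e34 : word n) : R :=
  (decB c (wxor (encB c b) (wxor (wxor (wxor e13 e14) e23) e34)) != b)%:R.

Lemma nc_mean_errA : nc_mean errA = bsc_error p14 (encA c) (decA c).
Proof.
rewrite /nc_mean /bsc_error /errA; apply: eq_bigr => a _.
rewrite sumr_const card_ord -[LHS]mulr_natl [MA%:R^-1 * _]mulrC !mulrA.
rewrite divff ?pnatr_eq0 -?lt0n // mul1r; congr (_ * _).
rewrite exchange_big /=; apply: eq_bigr => e14 _.
set x := (_ != a)%:R.
transitivity (\sum_(e13 : word n) bsc_weight p13 e13 * (bsc_weight p14 e14 * x)).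
  apply: eq_bigr => e13 _.
  transitivity (\sum_(e23 : word n) bsc_weight p23 e23 *
     (bsc_weight p13 e13 * (bsc_weight p14 e14 * x))); last first.
    by rewrite -mulr_suml sum_bsc_weight mul1r.
  apply: eq_bigr => e23 _; rewrite -mulr_suml -mulr_sumr sum_bsc_weight; ring.
by rewrite -mulr_suml sum_bsc_weight mul1r.
Qed.

Lemma nc_mean_errB :
  nc_mean errB = bsc_error (p_dd p13 p23 p34 p14) (encB c) (decB c).
Proof.
rewrite /nc_mean /bsc_error /errB exchange_big /=; apply: eq_bigr => b _.
rewrite sumr_const card_ord -[LHS]mulr_natl !mulrA divff ?pnatr_eq0 -?lt0n // mul1r.
congr (_ * _); rewrite p_ddE.
(* The total noise is split from the outside: first [e34], then [e23], then [e13] from [e14]. *)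
rewrite -(sum_bsc_conv _ _ (fun e => (decB c (wxor (encB c b) e) != b)%:R)).
under [RHS]eq_bigr do under eq_bigr do rewrite -mulrA.
under [RHS]eq_bigr do rewrite -mulr_sumr.
rewrite -(sum_bsc_conv _ _ (fun e => \sum_i bsc_weight p34 i *
  (decB c (wxor (encB c b) (wxor e i)) != b)%:R)).
under [RHS]eq_bigr do under eq_bigr do rewrite -mulrA.
under [RHS]eq_bigr do rewrite -mulr_sumr.
rewrite -(sum_bsc_conv _ _ (fun e => \sum_j bsc_weight p23 j * \sum_i bsc_weight p34 i *
  (decB c (wxor (encB c b) (wxor (wxor e j) i)) != b)%:R)).
apply: eq_bigr => e13 _; apply: eq_bigr => e14 _; rewrite mulr_sumr.
apply: eq_bigr => e23 _; rewrite mulrA mulr_sumr.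
by apply: eq_bigr => e34 _; rewrite mulrA.
Qed.

Lemma nc_errorE : nc_error p13 p14 p23 p34 c = nc_mean
  (fun a b e13 e14 e23 e34 => 1 - (1 - errA a b e13 e14 e23 e34) *
                                  (1 - errB a b e13 e14 e23 e34)).
Proof.
rewrite /nc_error /nc_mean.
do 2! [apply: eq_bigr => ? _]; congr (_ * _); do 4! [apply: eq_bigr => ? _].
rewrite /= /errA /errB; congr (_ * _).
set y := wxor (wxor _ _) (wxor _ _); set z := wxor (encB c _) (wxor _ _).
(* The codeword of [a] enters through both [y34] and [y14], and cancels. *)
have -> : y = z.
  by apply/ffunP => i; rewrite !ffunE; do !case: (_ i).
by case: eqP => _; case: eqP => _; rewrite /=; ring.
Qed.

Lemma nc_error_geA : bsc_error p14 (encA c) (decA c) <= nc_error p13 p14 p23 p34 c.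
Proof.
rewrite nc_errorE -nc_mean_errA; apply: nc_mean_le => *.
by rewrite /errA /errB; do 2! case: (_ != _) => /=; lra.
Qed.

Lemma nc_error_geB : bsc_error (p_dd p13 p23 p34 p14) (encB c) (decB c) <=
  nc_error p13 p14 p23 p34 c.
Proof.
rewrite nc_errorE -nc_mean_errB; apply: nc_mean_le => *.
by rewrite /errA /errB; do 2! case: (_ != _) => /=; lra.
Qed.

Lemma nc_error_le : nc_error p13 p14 p23 p34 c <=
  bsc_error p14 (encA c) (decA c) +
  bsc_error (p_dd p13 p23 p34 p14) (encB c) (decB c).
Proof.
rewrite nc_errorE -nc_mean_errB -nc_mean_errA -nc_meanD; apply: nc_mean_le => *.
by rewrite /errA /errB; do 2! case: (_ != _) => /=; lra.
Qed.

End Code.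

Lemma conv_hull2_convex (S : set (R * R)) : convex_set2 S -> conv_hull2 S = S.
Proof.
move=> cS; apply/seteqP; split=> x; first by apply.
by move=> Sx T _; apply.
Qed.

Lemma convex_box (a b : R) : convex_set2
  [set r : R * R | 0 <= r.1 /\ 0 <= r.2 /\ r.1 <= a /\ r.2 <= b].
Proof.
by move=> x y t /= [? [? [? ?]]] [? [? [? ?]]] t0 t1; repeat split; nra.
Qed.

End Network.

Theorem theorem1 (R : realType) (p13 p14 p23 p34 : R) :
  0 <= p13 <= 1 -> 0 <= p14 <= 1 -> 0 <= p23 <= 1 -> 0 <= p34 <= 1 ->
  nc_region p13 p14 p23 p34 =
  conv_hull2 [set r : R * R | 0 <= r.1 /\ 0 <= r.2 /\
                 r.1 <= bsc_cap p14 /\ r.2 <= bsc_cap (p_dd p13 p23 p34 p14)].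
Proof.
move=> h13 h14 h23 h34; rewrite conv_hull2_convex; last exact: convex_box.
have hdd := p_dd_itv h13 h14 h23 h34.
apply/seteqP; split=> -[rA rB] /= hr.
  (* Any tolerance below the 1/2 of the converse gives the contradiction. *)
  have quarter0 : 0 < 1 / 4 :> R by [].
  (* The box is closed, so slack [d] suffices; each violated inequality is refuted with [d] equal to
     its violation. *)
  suff close d : 0 < d -> [/\ - d < rA, - d < rB, rA < bsc_cap p14 + d
      & rB < bsc_cap (p_dd p13 p23 p34 p14) + d].
    split; [|split; [|split]]; rewrite leNgt; apply/negP => lt.
    - by have [] := close (- rA) _; lra.
    - by have [] := close (- rB) _; lra.
    - by have [] := close (rA - bsc_cap p14) _; lra.
    - by have [] := close (rB - bsc_cap (p_dd p13 p23 p34 p14)) _; lra.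
  move=> d0; have [RA [RB [[RA0 [RB0 ach]] []]]] := hr d d0.
  rewrite !ltr_norml /= => /andP[a1 a2] /andP[b1 b2].
  have [N0 code] := ach _ quarter0.
  have leA : RA <= bsc_cap p14.
    rewrite leNgt; apply/negP => /(bsc_converse h14 RA0)[N1 conv].
    have [c err] := code _ (leq_maxl N0 N1).
    have [MA0 _ _] := nmsg_bounds (maxn N0 N1) RA0.
    have [MB0 _ _] := nmsg_bounds (maxn N0 N1) RB0.
    have := conv _ (leq_maxr N0 N1) (encA c) (decA c).
    have := nc_error_geA h13 h14 h23 h34 MB0 c; lra.
  have leB : RB <= bsc_cap (p_dd p13 p23 p34 p14).
    rewrite leNgt; apply/negP => /(bsc_converse hdd RB0)[N1 conv].
    have [c err] := code _ (leq_maxl N0 N1).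
    have [MA0 _ _] := nmsg_bounds (maxn N0 N1) RA0.
    have [MB0 _ _] := nmsg_bounds (maxn N0 N1) RB0.
    have := conv _ (leq_maxr N0 N1) (encB c) (decB c).
    have := nc_error_geB h13 h14 h23 h34 MA0 c; lra.
  split; lra.
case: hr => rA0 [rB0 [leA leB]] d d0.
(* Boundary rates are only limits of achievable ones: step down by [d / 2], or to 0 when that might
   go negative. *)
have approach (r C : R) : 0 <= r -> r <= C ->
    exists r', [/\ 0 <= r', r' = 0 \/ r' < C & `|r' - r| < d].
  move=> r0 rC; have [lt|ge] := ltP r (d / 2).
    by exists 0; split=> //; [left|rewrite sub0r normrN ger0_norm //; lra].
  exists (r - d / 2); split; [lra | right; lra |].
  by rewrite addrAC subrr add0r normrN ger0_norm; lra.
have [RA [RA0 RAC dA]] := approach _ _ rA0 leA.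
have [RB [RB0 RBC dB]] := approach _ _ rB0 leB.
exists RA, RB; split=> //; split=> //; split=> // eps eps0.
have eps20 : 0 < eps / 2 by rewrite divr_gt0.
have [N1 codeA] := bsc_direct h14 RA0 RAC eps20.
have [N2 codeB] := bsc_direct hdd RB0 RBC eps20.
exists (maxn N1 N2) => n; rewrite geq_max => /andP[/codeA[eA [fA errA]] /codeB[eB [fB errB]]].
have [MA0 _ _] := nmsg_bounds n RA0.
have [MB0 _ _] := nmsg_bounds n RB0.
exists (NCCode eA eB fA fB).
by apply: le_trans (nc_error_le h13 h14 h23 h34 MA0 MB0 _) _ => /=; lra.
Qed.
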